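(* Let $\mathbb{V}=U\oplus W$ be an $n$-dimensional vector space ($n\ge 2$) over a finite field $\mathcal{F}$ with $q$ elements, where $U$ and $W$ are nonzero subspaces. Then the minimum degree $\delta$ of the direct sum graph $\Gamma_{U\oplus W}(\mathbb{V})$ is $(q-1)^2q^{n-2}-1$.
   Context: Let $\dim U=r$, $\dim W=s$, $r+s=n$. Fix a basis $\{\alpha_1,\dots,\alpha_r\}$ of $U$ and a basis $\{\beta_1,\dots,\beta_s\}$ of $W$; every $x\in\mathbb{V}$ is written uniquely as $x=\sum_i a_i\alpha_i+\sum_j b_j\beta_j$. The direct sum graph $\Gamma_{U\oplus W}(\mathbb{V})$ is the simple graph whose vertex set is $\{x=u+w: u\in U, w\in W, u\neq 0, w\neq 0\}$, in which two distinct vertices $x,y$ are adjacent iff there is an index $i$ such that the coefficient of $\alpha_i$ is nonzero in both $x$ and $y$, and there is an index $j$ such that the coefficient of $\beta_j$ is nonzero in both $x$ and $y$. *)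

(* Defs.v *)
From mathcomp Require Import all_boot all_order all_algebra all_field.

Set Implicit Arguments.
Unset Strict Implicit.
Unset Printing Implicit Defensive.

Import GRing.Theory.
Local Open Scope ring_scope.

Record sgraph := SGraph {
  vertex :> finType;
  adj : rel vertex;
  adj_sym : symmetric adj;
  adj_irr : irreflexive adj
}.

Definition degree (G : sgraph) (x : G) : nat := #|[set y | adj x y]|.

(* Every degree is smaller than [#|G|], so for nonempty [G] the default value
   does not affect the minimum. *)
Definition min_degree (G : sgraph) : nat :=
  \big[minn/#|G|]_(x : G) degree x.

Section DirectSumGraph.

Variables (F : finFieldType) (vT : vectType F) (U W : {vspace vT}).
Variables (r s : nat) (alpha : r.-tuple vT) (beta : s.-tuple vT).

(* [finvect_type vT] is [vT] with the finite type structure that a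
   finite-dimensional space over a finite field carries. *)
Definition is_ds_vertex (x : finvect_type vT) : bool :=
  [exists u : finvect_type vT, exists w : finvect_type vT,
    [&& (u : vT) \in U, (w : vT) \in W, u != 0, w != 0 & x == u + w]].

Definition ds_vertex : finType := {x : finvect_type vT | is_ds_vertex x}.

(* If [alpha] and [beta] are bases of [U] and [W] and [vT] is the direct sum
   of [U] and [W], then [alpha ++ beta] is a basis of [vT], and these are the
   coefficients [a_i], [b_j] of [x = \sum_i a_i alpha_i + \sum_j b_j beta_j]. *)
Definition coefU (i : 'I_r) (x : vT) : F :=
  coord (cat_tuple alpha beta) (lshift s i) x.

Definition coefW (j : 'I_s) (x : vT) : F :=
  coord (cat_tuple alpha beta) (rshift r j) x.

Definition ds_adj : rel ds_vertex := fun x y =>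
  [&& x != y,
      [exists i, (coefU i (val x) != 0) && (coefU i (val y) != 0)]
    & [exists j, (coefW j (val x) != 0) && (coefW j (val y) != 0)]].

Lemma ds_adj_sym : symmetric ds_adj.
Proof.
move=> x y; rewrite /ds_adj eq_sym; congr [&& _, _ & _];
  by apply: eq_existsb => i; rewrite andbC.
Qed.

Lemma ds_adj_irr : irreflexive ds_adj.
Proof. by move=> x; rewrite /ds_adj eqxx. Qed.

Definition direct_sum_graph : sgraph := SGraph ds_adj_sym ds_adj_irr.

End DirectSumGraph.

(* Main.v *)
(** A vertex is a vector whose support meets both parts of the basis.  If [x]
    has nonzero coefficients at [alpha_i] and [beta_j], every vector with the
    same property is [x] or a neighbour of [x]; there are
    [(q - 1)^2 q^(n - 2)] such vectors, and for [x = alpha_i + beta_j] no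
    other neighbour exists. *)

Require Import Defs.
From mathcomp Require Import all_boot all_order all_algebra all_field.

Set Implicit Arguments.
Unset Strict Implicit.
Unset Printing Implicit Defensive.

Import GRing.Theory.
Local Open Scope ring_scope.

Lemma min_degree_eq (G : sgraph) (m : nat) (x : G) :
  degree x = m -> (forall y : G, m <= degree y)%N -> min_degree G = m.
Proof.
move=> dx dmin; apply/eqP; rewrite eqn_leq; apply/andP; split.
  rewrite /min_degree -dx; have := mem_index_enum x.
  elim: (index_enum _) => //= y e IHe; rewrite inE big_cons geq_min.
  by case/predU1P => [<-|/IHe->]; rewrite ?leqnn ?orbT.
(* The default value [#|G|] enters the minimum too. It is at least [m] because [m] is itself the
   degree of [x]. *)
apply: (big_ind (leq m)) => [|a b ma mb|y _]; last exact: dmin.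
  by rewrite -dx max_card.
by rewrite leq_min ma.
Qed.

(** Coordinates in [b] identify vectors with functions from ['I_n] to [F]. Each of the two distinct
    constrained coordinates has [#|F| - 1] choices, and each of the others has [#|F|]. *)
Lemma card_two_coord_neq0 (F : finFieldType) (vT : vectType F) (n : nat)
    (b : n.-tuple vT) (k l : 'I_n) :
  basis_of fullv b -> k != l ->
  #|[set y : finvect_type vT | (coord b k y != 0) && (coord b l y != 0)]|
    = ((#|F| - 1) ^ 2 * #|F| ^ (n - 2))%N.
Proof.
move=> bb kl; have fb := basis_free bb.
pose f (c : {ffun 'I_n -> F}) : finvect_type vT := \sum_i c i *: b`_i.
have coord_f c i : coord b i (f c) = c i by exact: coord_sum_free.
have f_inj : injective f.
  by move=> c d fcd; apply/ffunP => i; rewrite -!coord_f fcd.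
(* [A i] holds the values allowed at coordinate [i], so the set to be counted is the image under [f]
   of a product of sets. *)
pose A (i : 'I_n) : {pred F} := if i \in [set k; l] then predC1 0 else predT.
have -> : [set y : finvect_type vT | (coord b k y != 0) && (coord b l y != 0)]
          = f @: family A.
  apply/setP => y; rewrite inE; apply/andP/imsetP.
    case=> yk yl; exists [ffun i => coord b i (y : vT)].
      apply/familyP => i; rewrite ffunE /A; case: ifP => //.
      by rewrite !inE => /orP[] /eqP->.
    rewrite /f {1}(coord_basis bb (memvf (y : vT))).
    by apply: eq_bigr => i _; rewrite ffunE.
  case=> c /familyP Ac ->; rewrite !coord_f; move: (Ac k) (Ac l).
  by rewrite /A !inE !eqxx orbT.
rewrite card_imset // card_family foldrE big_map big_enum /=.
rewrite (bigID (mem [set k; l])) /=; congr (_ * _)%N.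
  rewrite (eq_bigr (fun=> (#|F| - 1)%N)) => [|i ikl].
    by rewrite prod_nat_const cards2 kl.
  by rewrite subn1 -(cardC1 (0 : F)) /A ikl.
rewrite (eq_bigr (fun=> #|F|)) => [|i ikl].
  rewrite prod_nat_const; congr (_ ^ _)%N.
  (* The exponent [n - 2] is the size of the complement of [[set k; l]], which has two elements by
     [kl]. *)
  rewrite -[in RHS](card_ord n) -(cardC [set k; l]) cards2 kl addKn.
  by apply: eq_card => i; rewrite !inE.
by rewrite /A (negPf ikl).
Qed.

Section DirectSumGraphDegree.

Variables (F : finFieldType) (vT : vectType F) (U W : {vspace vT}).
Variables (r s : nat) (alpha : r.-tuple vT) (beta : s.-tuple vT).
Hypothesis UW_full : (U + W)%VS = fullv.
Hypothesis UW_direct : directv (U + W)%VS.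
Hypothesis alpha_basis : basis_of U alpha.
Hypothesis beta_basis : basis_of W beta.

Local Notation basis := (cat_tuple alpha beta).
Local Notation cU := (coefU alpha beta).
Local Notation cW := (coefW alpha beta).

Lemma cat_basis_fullv : basis_of fullv basis.
Proof. by rewrite -UW_full; exact: cat_basis. Qed.

Lemma nth_lshift (i : 'I_r) : basis`_(lshift s i) = alpha`_i.
Proof. by rewrite nth_cat size_tuple /= ltn_ord. Qed.

Lemma nth_rshift (j : 'I_s) : basis`_(rshift r j) = beta`_j.
Proof. by rewrite nth_cat size_tuple /= ltnNge leq_addr addKn. Qed.

Lemma coord_nth (k l : 'I_(r + s)) : coord basis k basis`_l = (k == l)%:R.
Proof.
by rewrite eq_sym; apply: coord_free; exact: basis_free cat_basis_fullv.
Qed.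

Lemma coef_sum (v : vT) :
  v = \sum_i cU i v *: alpha`_i + \sum_j cW j v *: beta`_j.
Proof.
rewrite {1}(coord_basis cat_basis_fullv (memvf v)) big_split_ord /=.
by congr (_ + _); apply: eq_bigr => i _; rewrite ?nth_lshift ?nth_rshift.
Qed.

(** The vector [w] expands in [beta] alone, and the entries of [beta] occupy the right-shifted
    positions of the joint basis. *)
Lemma coefU_W (i : 'I_r) (w : vT) : w \in W -> cU i w = 0.
Proof.
move=> /(coord_basis beta_basis)->; rewrite /coefU linear_sum big1 // => j _.
by rewrite linearZ /= -nth_rshift coord_nth eq_lrshift mulr0.
Qed.

Lemma coefW_U (j : 'I_s) (u : vT) : u \in U -> cW j u = 0.
Proof.
move=> /(coord_basis alpha_basis)->; rewrite /coefW linear_sum big1 // => i _.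
by rewrite linearZ /= -nth_lshift coord_nth eq_rlshift mulr0.
Qed.

(** Each [cU i] vanishes on [W] and each [cW j] on [U]. Hence the coefficients of [u + w] on the two
    sides are those of [u] and of [w], and a component is zero exactly when all its coefficients
    are. *)
Lemma is_ds_vertexE (x : finvect_type vT) :
  is_ds_vertex U W x
    = [exists i, cU i x != 0] && [exists j, cW j x != 0].
Proof.
apply/idP/andP => [/existsP[u /existsP[w]]|].
  case/and5P=> uU wW u0 w0 /eqP->; split.
    apply: contraNT u0; rewrite negb_exists => /forallP c0.
    rewrite [u]coef_sum !big1 ?addr0 // => i _.
      by rewrite coefW_U // scale0r.
    have := c0 i; rewrite negbK /coefU linearD /= -!/(cU _ _).
    rewrite (coefU_W _ wW) addr0.
    by move/eqP->; rewrite scale0r.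
  apply: contraNT w0; rewrite negb_exists => /forallP c0.
  rewrite [w]coef_sum !big1 ?addr0 // => i _; last first.
    by rewrite coefU_W // scale0r.
  have := c0 i; rewrite negbK /coefW linearD /= -!/(cW _ _).
  rewrite (coefW_U _ uU) add0r.
  by move/eqP->; rewrite scale0r.
case=> /existsP[i xi] /existsP[j xj].
have : (x : vT) \in (U + W)%VS by rewrite UW_full memvf.
case/memv_addP=> u uU [w wW xuw].
apply/existsP; exists u; apply/existsP; exists w.
rewrite uU wW -xuw eqxx andbT /=; apply/andP; split.
  by apply: contraNneq xi => u0; rewrite xuw u0 add0r coefU_W.
by apply: contraNneq xj => w0; rewrite xuw w0 addr0 coefW_U.
Qed.

Local Notation G := (direct_sum_graph U W alpha beta).

(** The right-hand set is the closed neighbourhood of [x]; the successor accounts for [x] itself.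
    Counting among all vectors adds nothing, since a vector in this set has nonzero coefficients on
    both sides and so is a vertex. *)
Lemma degree_direct_sum_graph (x : G) :
  (degree x).+1 = #|[set y : finvect_type vT |
    [exists i, (cU i (val x) != 0) && (cU i y != 0)]
      && [exists j, (cW j (val x) != 0) && (cW j y != 0)]]|.
Proof.
have := valP x; rewrite is_ds_vertexE => /andP[/existsP[i xi] /existsP[j xj]].
have x_notin : x \notin [set y | adj x y] by rewrite inE adj_irr.
(* The added [1] is read as the truth value of [x_notin], so that [cardsU1] absorbs [x] into its
   neighbourhood. *)
rewrite /degree -add1n -[1%N]/(true : nat) -x_notin -cardsU1.
rewrite -(card_imset _ val_inj); apply: eq_card => y.
rewrite inE; apply/imsetP/andP => [[z + ->]|[]].
  rewrite !inE => /predU1P[->|/and3P[_ -> ->] //].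
  by split; apply/existsP; [exists i|exists j]; apply/andP.
move=> xyU xyW; have yV : is_ds_vertex U W y.
  rewrite is_ds_vertexE; case/existsP: xyU => k /andP[_ yk].
  by case/existsP: xyW => l /andP[_ yl]; apply/andP; split; apply/existsP;
    [exists k|exists l].
exists (Sub y yV) => //; rewrite !inE /= /ds_adj SubK xyU xyW !andbT eq_sym.
by case: eqP.
Qed.

Local Notation m := ((#|F| - 1) ^ 2 * #|F| ^ (r + s - 2))%N.

Lemma card_coefUW_neq0 (i : 'I_r) (j : 'I_s) :
  #|[set y : finvect_type vT | (cU i y != 0) && (cW j y != 0)]| = m.
Proof. by apply: card_two_coord_neq0 cat_basis_fullv _; rewrite eq_lrshift. Qed.

Lemma degree_direct_sum_graph_ge (x : G) : (m - 1 <= degree x)%N.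
Proof.
have := valP x; rewrite is_ds_vertexE => /andP[/existsP[i xi] /existsP[j xj]].
rewrite leq_subLR add1n degree_direct_sum_graph -(card_coefUW_neq0 i j).
apply/subset_leq_card/subsetP => y; rewrite !inE => /andP[yi yj].
by apply/andP; split; apply/existsP; [exists i|exists j]; apply/andP.
Qed.

Lemma degree_direct_sum_graph_eq (i : 'I_r) (j : 'I_s) :
  exists x : G, degree x = (m - 1)%N.
Proof.
pose v : finvect_type vT := alpha`_i + beta`_j.
have vU k : (cU k v != 0) = (k == i).
  rewrite /coefU linearD /= -nth_lshift -nth_rshift !coord_nth eq_lshift.
  by rewrite eq_lrshift addr0; case: (k == i); rewrite ?oner_eq0 ?eqxx.
have vW k : (cW k v != 0) = (k == j).
  rewrite /coefW linearD /= -nth_lshift -nth_rshift !coord_nth eq_rshift.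
  by rewrite eq_rlshift add0r; case: (k == j); rewrite ?oner_eq0 ?eqxx.
have vV : is_ds_vertex U W v.
  rewrite is_ds_vertexE; apply/andP.
  by split; apply/existsP; [exists i; rewrite vU|exists j; rewrite vW].
(* The degree is written as its successor minus one, to make the closed neighbourhood count
   applicable. *)
exists (Sub v vV); rewrite -(card_coefUW_neq0 i j) -[LHS]subn0 -subSS.
rewrite degree_direct_sum_graph /=.
congr (_ - _)%N; apply: eq_card => y; rewrite !inE.
(* By [vU] and [vW], only the indices [i] and [j] can witness the two existentials. *)
congr (_ && _); apply/existsP/idP => [[k]|yk].
- by rewrite vU => /andP[/eqP->].
- by exists i; rewrite vU eqxx.
- by rewrite vW => /andP[/eqP->].
- by exists j; rewrite vW eqxx.
Qed.

End DirectSumGraphDegree.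

Theorem theorem3p1 (F : finFieldType) (vT : vectType F) (U W : {vspace vT})
    (q n r s : nat) (alpha : r.-tuple vT) (beta : s.-tuple vT)
    (hq : #|F| = q) (hn : \dim (fullv : {vspace vT}) = n) (n_ge2 : (2 <= n)%N)
    (U_neq0 : U <> 0%VS) (W_neq0 : W <> 0%VS)
    (UW_full : (U + W)%VS = fullv) (UW_direct : directv (U + W)%VS)
    (alpha_basis : basis_of U alpha) (beta_basis : basis_of W beta) :
  min_degree (direct_sum_graph U W alpha beta)
    = ((q - 1) ^ 2 * q ^ (n - 2) - 1)%N.
Proof.
have rs : (r + s)%N = n.
  rewrite -hn; apply/esym.
  exact: size_basis (cat_basis_fullv UW_full UW_direct alpha_basis beta_basis).
(* Both subspaces being nonzero, each basis has a first vector; these two serve as [alpha_i] and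
   [beta_j]. *)
have r_gt0 : (0 < r)%N.
  by rewrite -(size_basis alpha_basis) lt0n dimv_eq0; apply/eqP.
have s_gt0 : (0 < s)%N.
  by rewrite -(size_basis beta_basis) lt0n dimv_eq0; apply/eqP.
have [x dx] := degree_direct_sum_graph_eq UW_full UW_direct alpha_basis
  beta_basis (Ordinal r_gt0) (Ordinal s_gt0).
rewrite -hq -rs; apply: min_degree_eq dx _.
exact: degree_direct_sum_graph_ge.
Qed.
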